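(* Consider the completely controllable and observable system $\dot x=Ax+Bu+Ew$, $z=Dx$ ($x\in\mathbb R^n$, $u\in\mathbb R^r$, $z\in\mathbb R^d$, $w\in\mathbb R^p$, $\operatorname{rank}B=r$, $\operatorname{rank}D=d$; $(A,B)$ controllable, $(A,D)$ observable). Let $\tilde\phi(s)=s^\beta+\alpha_{\beta-1}s^{\beta-1}+\cdots+\alpha_0$ be a real polynomial all of whose zeros have non-negative real parts, and suppose every component $f$ of the disturbance $w(t)$ and of the reference signal $z_{ref}(t)\in\mathbb R^d$ satisfies $f^{(\beta)}+\alpha_{\beta-1}f^{(\beta-1)}+\cdots+\alpha_0f=0$. Let $F=\operatorname{diag}(F_1,\dots,F_d)$ and $\Gamma=\operatorname{diag}(\gamma_1,\dots,\gamma_d)$, where $F_i$ are real $\beta\times\beta$ matrices with $\det(sI_\beta-F_i)=\tilde\phi(s)$ and $\gamma_i$ are real $\beta$-dimensional column vectors. Then the following conditions are sufficient for the existence of constant matrices $K_1$ ($r\times n$), $K_2$ ($r\times d\beta$) such that the servo-regulator $$\dot q=Fq+\Gamma(z-z_{ref}),\qquad u=K_1x+K_2q$$ assures asymptotic tracking $z(t)-z_{ref}(t)\to0$ as $t\to\infty$ for all such disturbances $w(t)$ and all such reference signals $z_{ref}(t)$ (with arbitrary initial conditions): a) the pair $(A,B)$ is stabilizable; b) $d\le r$; c) the transmission zeros of the system $\dot x=Ax+Bu$, $y=Dx$ do not coincide with eigenvalues of $F$ (i.e. with zeros of $\tilde\phi(s)$); d) the pairs $(F_i,\gamma_i)$,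 $i=1,\dots,d$, are stabilizable.
   Context: Transmission zeros: for the completely controllable and observable system $\dot x=Ax+Bu$, $y=Dx$ (for which the sets of transmission, invariant and system zeros coincide), a complex number $s_0$ is a transmission zero if $\operatorname{rank}\begin{bmatrix} s_0I_n-A & -B \\ D & O \end{bmatrix}<n+\min(r,d)$. A pair $(A,B)$ is stabilizable if $\operatorname{rank}[\lambda I-A,B]$ is full (equal to the order of $A$) for every eigenvalue $\lambda$ of $A$ with $\operatorname{Re}\lambda\ge0$. *)

(* Defs.v *)
From HB Require Import structures.
From mathcomp Require Import all_boot all_order all_algebra.
From mathcomp Require Import complex.
From mathcomp Require Import all_classical all_reals all_analysis.

Set Implicit Arguments.
Unset Strict Implicit.
Unset Printing Implicit Defensive.

Import Order.TTheory GRing.Theory Num.Theory.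
Import numFieldNormedType.Exports.

Local Open Scope classical_set_scope.
Local Open Scope ring_scope.

Definition complex_mx (R : realType) (m n : nat) (A : 'M[R]_(m, n)) :
    'M[R[i]]_(m, n) :=
  map_mx (real_complex R) A.

(* The Kalman matrix [B, AB, ..., A^(n-1)B] has full rank. *)
Definition controllable (R : realType) (n r : nat)
    (A : 'M[R]_n) (B : 'M[R]_(n, r)) : Prop :=
  \rank (\mxrow_(k < n) (A ^+ k *m B)) = n.

(* The Kalman matrix with block rows D, DA, ..., DA^(n-1) has full rank. *)
Definition observable (R : realType) (n d : nat)
    (A : 'M[R]_n) (D : 'M[R]_(d, n)) : Prop :=
  \rank (\mxcol_(k < n) (D *m A ^+ k)) = n.

Definition stabilizable (R : realType) (n r : nat)
    (A : 'M[R]_n) (B : 'M[R]_(n, r)) : Prop :=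
  forall l : R[i], eigenvalue (complex_mx A) l -> 0 <= complex.Re l ->
    \rank (row_mx (l%:M - complex_mx A) (complex_mx B)) = n.

Definition transmission_zero (R : realType) (n r d : nat)
    (A : 'M[R]_n) (B : 'M[R]_(n, r)) (D : 'M[R]_(d, n)) (s : R[i]) : Prop :=
  (\rank (block_mx (s%:M - complex_mx A) (- complex_mx B)
                   (complex_mx D) (0 : 'M[R[i]]_(d, r)))
     < n + minn r d)%N.

(* [f] satisfies phi(d/dt) f = 0.  Time is t > 0 here and in [closed_loop], so
   that functions on [0, +oo[ with arbitrary values at t = 0 are all covered
   by total functions on R whose values for t <= 0 are irrelevant.  Since
   [derive1n] is total, differentiability is required explicitly. *)
Definition lin_ode_sol (R : realType) (phi : {poly R}) (f : R -> R) : Prop :=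
  forall t : R, 0 < t ->
    (forall k : nat, (k < (size phi).-1)%N -> derivable (derive1n k f) t 1) /\
    \sum_(k < size phi) phi`_k * derive1n k f t = 0.

Definition all_components_ode (R : realType) (m : nat) (phi : {poly R})
    (f : R -> 'cV[R]_m) : Prop :=
  forall j : 'I_m, lin_ode_sol phi (fun t => f t j 0).

(* The row dimension [\sum_(i < d) b] is d * b, in the form used by [\mxdiag]. *)
Definition model_F (R : realType) (d b : nat) (F : 'I_d -> 'M[R]_b) :
    'M[R]_(\sum_(i < d) b) :=
  \mxdiag_(i < d) F i.

(* diag(g_1, ..., g_d): its i-th block row has g_i in column i, 0 elsewhere. *)
Definition model_Gamma (R : realType) (d b : nat) (g : 'I_d -> 'cV[R]_b) :
    'M[R]_(\sum_(i < d) b, d) :=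
  \mxcol_(i < d) (g i *m delta_mx 0 i).

Definition closed_loop (R : realType) (n r d p m : nat)
    (A : 'M[R]_n) (B : 'M[R]_(n, r)) (E : 'M[R]_(n, p)) (D : 'M[R]_(d, n))
    (F : 'M[R]_m) (G : 'M[R]_(m, d)) (K1 : 'M[R]_(r, n)) (K2 : 'M[R]_(r, m))
    (w : R -> 'cV[R]_p) (zref : R -> 'cV[R]_d)
    (x : R -> 'cV[R]_n) (q : R -> 'cV[R]_m) : Prop :=
  forall t : R, 0 < t ->
    let z := D *m x t in
    let u := K1 *m x t + K2 *m q t in
    is_derive t (1 : R) x (A *m x t + B *m u + E *m w t) /\
    is_derive t (1 : R) q (F *m q t + G *m (z - zref t)).

Definition assures_tracking (R : realType) (n r d p m : nat)
    (A : 'M[R]_n) (B : 'M[R]_(n, r)) (E : 'M[R]_(n, p)) (D : 'M[R]_(d, n))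
    (F : 'M[R]_m) (G : 'M[R]_(m, d)) (K1 : 'M[R]_(r, n)) (K2 : 'M[R]_(r, m))
    (phi : {poly R}) : Prop :=
  forall (w : R -> 'cV[R]_p) (zref : R -> 'cV[R]_d),
    all_components_ode phi w -> all_components_ode phi zref ->
  forall (x : R -> 'cV[R]_n) (q : R -> 'cV[R]_m),
    closed_loop A B E D F G K1 K2 w zref x q ->
    D *m x t - zref t @[t --> +oo] --> (0 : 'cV[R]_d).

(* Main.v *)
(** Write the plant together with the internal model as X' = MX + forcing, and
    let Y be phi(d/dt) applied to X. Since phi(d/dt) annihilates the forcing,
    Y' = MY, so Y -> 0 as soon as M is Hurwitz. On the i-th block
    q_i' = F_i q_i + g_i e_i, controllability of (F_i, g_i) gives a row c with
    c F_i^k g_i = [k = b-1]; then (c q_i)^(k) = c F_i^k q_i for k < b and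
    Cayley-Hamilton yields phi(d/dt)(c q_i) = e_i. Hence the tracking error
    e_i is a linear image of Y and tends to 0.

    By the Hautus test the augmented pair is controllable: a left eigenvector
    that annihilates the input matrix would make an eigenvalue of F a
    transmission zero, or contradict controllability of (A, B) or (F_i, g_i).
    Dead-beat control applied to the pair shifted by the identity then gives
    feedback gains for which M + 1 is nilpotent, and f' = -f + g with g -> 0
    implies f -> 0, so Y -> 0 by descending through the powers of M + 1. *)
Require Import Defs.
From HB Require Import structures.
From mathcomp Require Import all_boot all_order all_algebra.
From mathcomp Require Import complex.
From mathcomp Require Import all_classical all_reals all_analysis.

Set Implicit Arguments.
Unset Strict Implicit.
Unset Printing Implicit Defensive.

Import Order.TTheory GRing.Theory Num.Theory.
Import numFieldNormedType.Exports.

Local Open Scope classical_set_scope.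
Local Open Scope ring_scope.

(** * Controllability and dead-beat feedback *)

Lemma trmx_exp (R : comPzRingType) n (A : 'M[R]_n) k : (A ^+ k)^T = A^T ^+ k.
Proof.
elim: k => [|k IH]; first by rewrite !expr0 trmx1.
by rewrite exprS exprSr -!mulmxE trmx_mul IH.
Qed.

Lemma map_mx_exp (R S : pzRingType) (f : {rmorphism R -> S}) n (A : 'M[R]_n) k :
  map_mx f (A ^+ k) = map_mx f A ^+ k.
Proof.
elim: k => [|k IH]; first by rewrite !expr0 map_mx1.
by rewrite !exprS -!mulmxE map_mxM IH.
Qed.

Lemma Cayley_Hamilton_sum (R : comNzRingType) n (A : 'M[R]_n) :
  \sum_(k < n.+1) (char_poly A)`_k *: A ^+ k = 0.
Proof.
case: n A => [|n] A; first by rewrite [LHS]flatmx0 [RHS]flatmx0.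
rewrite -[RHS](Cayley_Hamilton A) /horner_mx /horner_morph.
rewrite (horner_coef_wide _ (n := n.+2)); last first.
  by rewrite (leq_trans (size_poly _ _)) // size_char_poly.
apply: eq_bigr => k _; rewrite coef_map /=.
by rewrite -mul_scalar_mx mulmxE.
Qed.

Section FieldControl.
Variable K : fieldType.

(** Full row rank of the Kalman matrix, phrased as triviality of its left kernel. *)
Definition kalman_full n r (A : 'M[K]_n) (B : 'M[K]_(n, r)) :=
  forall v : 'rV[K]_n,
    (forall k, (k < n)%N -> v *m A ^+ k *m B = 0) -> v = 0.

(** The Popov-Belevitch-Hautus test on left eigenvectors. Only eigenvalues lying in [K] are tested,
    so it is as strong as [kalman_full] when [K] is algebraically closed. *)
Definition hautus n r (A : 'M[K]_n) (B : 'M[K]_(n, r)) :=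
  forall (l : K) (v : 'rV[K]_n), v *m A = l *: v -> v *m B = 0 -> v = 0.

Lemma kalman_hautus n r (A : 'M[K]_n) (B : 'M[K]_(n, r)) :
  kalman_full A B -> hautus A B.
Proof.
move=> kAB l v vA vB; apply: kAB => k _.
suff -> : v *m A ^+ k = l ^+ k *: v by rewrite -scalemxAl vB scaler0.
elim: k => [|k IH]; first by rewrite !expr0 mulmx1 scale1r.
by rewrite !exprSr -mulmxE mulmxA IH -scalemxAl vA scalerA.
Qed.

(** The rows of [v] split into a part [v *m P], driven by the gain [L], and a part [v *m Q], driven
    by the inputs [- U] prescribed row by row. [T] recovers the coordinates of [v *m Q] with respect
    to the rows of [v]. *)
Lemma split_feedback n r (A : 'M[K]_n) (B : 'M[K]_(r, n)) (L U : 'M[K]_(n, r))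
    (v P Q T : 'M[K]_n) :
  v *m P + v *m Q = v -> v *m Q *m T *m v = v *m Q ->
  v *m (A + (P *m L - Q *m T *m U) *m B) =
  v *m P *m (A + L *m B) + v *m Q *m T *m (v *m A - U *m B).
Proof.
move=> vd vQ.
rewrite !mulmxDr mulmxBl !mulmxBr !mulmxA vQ -{1}vd mulmxDl.
by rewrite mulmxN !mulmxA addrACA.
Qed.

Lemma complement_projections n (U V : 'M[K]_n) : (U <= V)%MS ->
  exists P Q : 'M[K]_n,
    [/\ forall v : 'M[K]_n, (v <= U)%MS -> v *m P = v /\ v *m Q = 0,
        V *m P + V *m Q = V, (V *m P <= U)%MS & (V *m Q <= V)%MS].
Proof.
move=> UV; pose W := (V :\: U)%MS.
have WU0 : (W :&: U)%MS = 0 by rewrite capmx_diff.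
have UW0 : (U :&: W)%MS = 0 by rewrite capmxC.
exists (proj_mx U W), (proj_mx W U); split.
- by move=> v vU; rewrite proj_mx_id // proj_mx_0.
- apply: add_proj_mx => //.
  rewrite -(eqmxP (introT eqmxP (addsmx_diff_cap_eq V U))).
  by rewrite addsmxC addsmxS // capmxSr.
- exact: proj_mx_sub.
- by rewrite (submx_trans (proj_mx_sub _ _ _)) // diffmxSl.
Qed.

(* Row vectors that some input sequence steers to 0 in at most [k] steps of
   [x |-> x *m A + u *m B]. *)
Definition deadbeat_flag n r (A : 'M[K]_n) (B : 'M[K]_(r, n)) k : 'M[K]_n :=
  iter k (fun V : 'M[K]_n => kermx (A *m cokermx (V + B)%MS)) 0.

Section Deadbeat.
Variables (n r : nat) (A : 'M[K]_n) (B : 'M[K]_(r, n)).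
Let V := deadbeat_flag A B.

Lemma deadbeat_flagS m (x : 'M[K]_(m, n)) k :
  (x <= V k.+1)%MS = (x *m A <= V k + B)%MS.
Proof. by rewrite /V /deadbeat_flag /= sub_kermx mulmxA -submxE. Qed.

Lemma deadbeat_flag_mono k : (V k <= V k.+1)%MS.
Proof.
elim: k => [|k IH]; first exact: sub0mx.
rewrite deadbeat_flagS; apply: (submx_trans _ (addsmxS IH (submx_refl B))).
by rewrite -deadbeat_flagS.
Qed.

Lemma deadbeat_flag_le j k : (j <= k)%N -> (V j <= V k)%MS.
Proof.
elim: k => [|k IH]; first by rewrite leqn0 => /eqP->; apply: submx_refl.
rewrite leq_eqVlt => /orP[/eqP->|]; first exact: submx_refl.
by rewrite ltnS => /IH jk; apply: submx_trans jk (deadbeat_flag_mono k).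
Qed.

(** The coefficient of the top term [B *m A ^+ k] is the input to cancel first. After that step,
    [x *m A - u2 *m B] satisfies the same hypothesis with one power less. *)
Lemma deadbeat_flag_kalman m (x : 'M[K]_(m, n)) k :
  (x *m A ^+ k <= \sum_(j < k) <<B *m A ^+ j>>)%MS -> (x <= V k)%MS.
Proof.
elim: k m x => [|k IH] m x.
  by rewrite big_ord0 expr0 mulmx1.
rewrite big_ord_recr /= => xS.
have {xS} /sub_addsmxP[[u1 u2] /= xE] :
    (x *m A ^+ k.+1 <= \sum_(j < k) <<B *m A ^+ j>> + B *m A ^+ k)%MS.
  by rewrite (submx_trans xS) // addsmxS // genmxE.
rewrite deadbeat_flagS; apply/sub_addsmxP.
have /submxP[C CE] : (x *m A - u2 *m B <= V k)%MS.
  apply: IH; rewrite mulmxBl -[x *m A *m _]mulmxA mulmxE -exprS xE.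
  by rewrite mulmxA addrK submxMl.
by exists (C, u2) => /=; rewrite -CE subrK.
Qed.

(** A single gain has to lower all levels of the flag at once. It is built level by level: a new
    level changes it only on a complement of the previous one. *)
Lemma deadbeat_feedback k :
  exists L : 'M[K]_(n, r), forall j, (j < k)%N ->
    (V j.+1 *m (A + L *m B) <= V j)%MS.
Proof.
elim: k => [|k [L HL]]; first by exists 0.
have /sub_addsmxP[[C U]] : (V k.+1 *m A <= V k + B)%MS.
  by rewrite -deadbeat_flagS.
rewrite [(_, _).1]/= [(_, _).2]/= => CE.
have [P [Q [PQid PQsum Psub Qsub]]] := complement_projections (deadbeat_flag_mono k).
(* On [V k] the projection [P] is the identity and [Q] is zero, so the old gain survives there. On
   the complement the input is [- U], which leaves [C *m V k] of [V k.+1 *m A]. *)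
exists (P *m L - Q *m pinvmx (V k.+1) *m U) => j.
rewrite ltnS leq_eqVlt => /orP[/eqP->|ltjk].
  have vQ := mulmxKpV Qsub.
  rewrite (split_feedback A B L U PQsum vQ).
  rewrite addmx_sub //; last by rewrite CE addrK mulmxA submxMl.
  case/submxP: Psub => T ->; rewrite -mulmxA mulmx_sub //.
  case: (k) HL => [|k'] HL; first by rewrite mul0mx.
  exact: submx_trans (HL k' (ltnSn k')) (deadbeat_flag_mono k').
have jk := deadbeat_flag_le ltjk.
have [vP vQ] := PQid _ jk; move: (V j.+1) vP vQ (HL j ltjk) => v vP vQ.
rewrite !mulmxDr !mulmxA mulmxBr !mulmxA.
by rewrite vP vQ !mul0mx subr0.
Qed.

Lemma deadbeat_nilpotent k :
  exists L : 'M[K]_(n, r), V k *m (A + L *m B) ^+ k = 0.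
Proof.
have [L HL] := deadbeat_feedback k; exists L.
elim: k HL => [|k IH] HL; first by rewrite mul0mx.
have /submxP[T TE] := HL k (ltnSn k).
rewrite exprS -mulmxE mulmxA TE -mulmxA IH ?mulmx0 // => j jk.
by rewrite HL // ltnS ltnW.
Qed.

End Deadbeat.

(** After transposition, the Kalman condition says that the whole space lies in level [n] of the
    flag, where [n] feedback steps lead to zero. *)
Lemma kalman_deadbeat n r (A : 'M[K]_n) (B : 'M[K]_(n, r)) :
  kalman_full A B -> exists L : 'M[K]_(r, n), (A + B *m L) ^+ n = 0.
Proof.
move=> kAB; have [L HL] := deadbeat_nilpotent A^T B^T n.
exists L^T; apply: trmx_inj.
rewrite trmx_exp linearD /= trmx_mul trmxK trmx0 -[RHS]HL -[LHS]mul1mx.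
suff /submxP[T ->] : (1%:M <= deadbeat_flag A^T B^T n)%MS.
  by rewrite -mulmxA HL mulmx0.
apply: deadbeat_flag_kalman; rewrite mul1mx.
set S := (\sum_(j < n) _)%MS; apply: submx_trans (submx1 _) _.
rewrite submxE mul1mx.
have: forall k, (k < n)%N -> B^T *m A^T ^+ k *m cokermx S = 0.
  move=> k kn; apply/eqP; rewrite -submxE.
  by rewrite (sumsmx_sup (Ordinal kn)) // genmxE.
move: (cokermx S) => T BT; apply/eqP/trmx_inj/row_matrixP => i.
rewrite trmx0 row0; apply: kAB => k kn; apply: trmx_inj.
rewrite trmx0 -mulmxA !trmx_mul trmx_exp tr_row trmxK colE mulmxA.
by rewrite BT // mul0mx.
Qed.

(** With a single input the Kalman matrix is square, hence invertible; [c] is the last row of its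
    inverse. *)
Lemma kalman_dual_vector b (F : 'M[K]_b.+1) (g : 'cV[K]_b.+1) :
  kalman_full F g -> exists c : 'rV[K]_b.+1,
    forall k, (k <= b)%N -> c *m F ^+ k *m g = (k == b)%:R%:M.
Proof.
move=> kFg; pose Q := \matrix_(i, j < b.+1) (F ^+ j *m g) i 0.
have Qcol j : col j Q = F ^+ j *m g.
  by apply/colP => i; rewrite !mxE.
have Qu : Q \in unitmx.
  rewrite -row_free_unit; apply: inj_row_free => v vQ; apply: kFg => k kb.
  by rewrite -mulmxA -(Qcol (Ordinal kb)) colE mulmxA vQ mul0mx.
exists (delta_mx 0 ord_max *m invmx Q) => k kb.
rewrite -mulmxA -(Qcol (Ordinal (kb : k < b.+1)%N)) colE mulmxA.
rewrite mulmxKV // -rowE; apply/rowP => i.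
by rewrite !ord1 !mxE !eqxx mulr1n andbT -val_eqE /= eq_sym.
Qed.

End FieldControl.

(** The row vectors killed by all [A ^+ k *m B] form a space [W] that is stable under [A] by
    Cayley-Hamilton. If it were nonzero, it would contain a left eigenvector of [A] killed by
    [B]. *)
Lemma hautus_kalman (C : numClosedFieldType) n r (A : 'M[C]_n) (B : 'M[C]_(n, r)) :
  hautus A B -> kalman_full A B.
Proof.
case: n A B => [|n] A B hAB v vAB; first by rewrite [v]thinmx0.
pose W := (\bigcap_(k < n.+1) kermx (A ^+ k *m B))%MS.
have WP m (x : 'M[C]_(m, n.+1)) :
    reflect (forall k, (k < n.+1)%N -> x *m A ^+ k *m B = 0) (x <= W)%MS.
  apply: (iffP sub_bigcapmxP) => [xW k kn|xW k _].
    by apply/eqP; rewrite -mulmxA -sub_kermx (xW (Ordinal kn)).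
  by rewrite sub_kermx mulmxA xW.
have WA : stablemx W A.
  have /WP W0 : (W <= W)%MS by [].
  apply/WP => k; rewrite ltnS leq_eqVlt => /orP[/eqP->|kn]; last first.
    by rewrite -(mulmxA W) mulmxE -exprS W0.
  have := congr1 (fun X => W *m X *m B) (Cayley_Hamilton_sum A).
  rewrite big_ord_recr /= mulmx0 mul0mx mulmxDr mulmxDl mulmx_sumr mulmx_suml.
  rewrite big1 ?add0r => [|i _].
    have := monicP (char_poly_monic A); rewrite lead_coefE size_char_poly /= => ->.
    by rewrite scale1r exprS -mulmxE mulmxA.
  by rewrite -scalemxAr -scalemxAl W0 ?scaler0.
have [W0|W_neq0] := eqVneq W 0.
  by apply/eqP; rewrite -submx0 -W0; apply/WP.
have rW : (0 < \rank W)%N by rewrite lt0n mxrank_eq0.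
(* The matrix below is the restriction of [A] to [W] in the coordinates of [row_base W]. *)
have [l /eigenvalueP[u uA u0]] :=
  eigenvalue_closed (row_base W *m A *m pinvmx (row_base W)) rW.
pose x := u *m row_base W.
have xW : (x <= W)%MS by rewrite (submx_trans (submxMl _ _)) ?eq_row_base.
case/eqP: u0; apply: (row_free_inj (row_base_free W)); rewrite mul0mx.
apply: (hAB l); last first.
  by have /WP/(_ 0%N isT) := xW; rewrite expr0 mulmx1.
have rA : row_base W *m A *m pinvmx (row_base W) *m row_base W = row_base W *m A.
  by rewrite mulmxKpV // eq_row_base (submx_trans _ WA) // submxMr ?eq_row_base.
by rewrite /x -mulmxA -rA mulmxA uA scalemxAl.
Qed.

(** * Extension of scalars *)

Lemma map_mxrow (S T : Type) (f : S -> T) m d (q : 'I_d -> nat)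
    (B : forall j, 'M[S]_(m, q j)) :
  map_mx f (\mxrow_j B j) = \mxrow_j map_mx f (B j).
Proof. by apply/matrixP => i j; rewrite !mxE. Qed.

Lemma map_mxcol (S T : Type) (f : S -> T) m d (q : 'I_d -> nat)
    (B : forall j, 'M[S]_(q j, m)) :
  map_mx f (\mxcol_j B j) = \mxcol_j map_mx f (B j).
Proof. by apply/matrixP => i j; rewrite !mxE. Qed.

Lemma map_mxdiag (S T : pzSemiRingType) (f : {rmorphism S -> T}) d (q : 'I_d -> nat)
    (B : forall i, 'M[S]_(q i)) :
  map_mx f (\mxdiag_i B i) = \mxdiag_i map_mx f (B i).
Proof.
have blockE i j :
    map_mx f (if i == j then conform_mx 0 (B i) else (0 : 'M[S]_(q i, q j))) =
    if i == j then conform_mx 0 (map_mx f (B i)) else 0.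
  by case: eqP => _; rewrite ?map_conform_mx map_mx0.
by apply/matrixP => i j; rewrite [LHS]mxE [in LHS]mxE [RHS]mxE -blockE mxE.
Qed.

Section MapMx.
Variables (K L : fieldType) (f : {rmorphism K -> L}).

(** This brings controllability proved with complex eigenvectors back to the reals, where the gains
    have to live. *)
Lemma kalman_full_map n r (A : 'M[K]_n) (B : 'M[K]_(n, r)) :
  kalman_full (map_mx f A) (map_mx f B) -> kalman_full A B.
Proof.
move=> kAB v vAB; apply/eqP; rewrite -(map_mx_eq0 f); apply/eqP/kAB => k kn.
by rewrite -map_mx_exp -!map_mxM vAB // map_mx0.
Qed.

Lemma kalman_rank n r (A : 'M[K]_n) (B : 'M[K]_(n, r)) :
  \rank (\mxrow_(k < n) (A ^+ k *m B)) = n -> kalman_full (map_mx f A) (map_mx f B).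
Proof.
move=> rAB v vAB.
have : row_free (map_mx f (\mxrow_(k < n) (A ^+ k *m B))).
  by rewrite row_free_map /row_free rAB.
move/row_free_inj; apply; rewrite mul0mx map_mxrow mul_mxrow -[RHS]mxrow0.
by apply/eq_mxrow => k; rewrite map_mxM map_mx_exp mulmxA vAB.
Qed.

End MapMx.

(** * Controllability of the plant with its internal model *)

Lemma hautus_shift (K : fieldType) n r (A : 'M[K]_n) (B : 'M[K]_(n, r)) (a : K) :
  hautus A B -> hautus (A + a%:M) B.
Proof.
move=> hAB l v vA; apply: (hAB (l - a)).
by rewrite scalerBl -vA mulmxDr mul_mx_scalar addrK.
Qed.

(** Let [(v1, v2)] be a left eigenvector killed by the input matrix. If [v2] is nonzero, [l] is an
    eigenvalue of the internal model and [(v1, - v2 *m G)] is in the left kernel of the system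
    matrix at [l], so [v2 *m G = 0]. Each block of [v2] then violates the test for [(F i, g i)]
    unless it is zero. Once [v2 = 0], the test for [(A, B)] gives [v1 = 0]. *)
Lemma hautus_servo (K : fieldType) n r d b (A : 'M[K]_n) (B : 'M[K]_(n, r))
    (D : 'M[K]_(d, n)) (F : 'I_d -> 'M[K]_b) (g : 'I_d -> 'cV[K]_b) :
  hautus A B -> (forall i, hautus (F i) (g i)) ->
  (forall l, eigenvalue (\mxdiag_(i < d) F i) l ->
     row_free (block_mx (l%:M - A) (- B) D 0)) ->
  hautus (block_mx A 0 (\mxcol_(i < d) (g i *m delta_mx 0 i) *m D) (\mxdiag_(i < d) F i))
         (col_mx B 0).
Proof.
set G := \mxcol_ i _; set FF := \mxdiag_ i _.
move=> hAB hF hZ l v; rewrite -[v]hsubmxK; set v1 := lsubmx v; set v2 := rsubmx v.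
rewrite mul_row_block scale_row_mx mul_row_col !mulmx0 add0r addr0.
move=> /eq_row_mx[v1A v2F] v1B.
suff v20 : v2 = 0.
  move: v1A; rewrite v20 mul0mx addr0 => v1A.
  by rewrite (hAB l v1) // row_mx0.
have [//|v2_neq0] := eqVneq v2 0.
have /hZ/row_free_inj Zinj : eigenvalue FF l by apply/eigenvalueP; exists v2.
have /eq_row_mx[_ /oppr_inj v2G] : row_mx v1 (- (v2 *m G)) = row_mx 0 (- 0).
  apply: Zinj; rewrite !mul_row_block.
  rewrite !mulmx0 !mul0mx !addr0 oppr0 mul0mx addr0 mulmxN v1B oppr0.
  by rewrite mulmxBr mul_mx_scalar -v1A mulNmx mulmxA -addrA -opprD subrr.
pose q i := submxrow v2 i.
have v2E : v2 = \mxrow_i q i by rewrite submxrowK.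
have qF i : q i *m F i = l *: q i.
  move: v2F; rewrite {1}v2E mul_mxrow_mxdiag => /(congr1 (fun X => submxrow X i)).
  by rewrite mxrowK => ->; apply/matrixP => k j; rewrite !mxE.
have qg i : q i *m g i = 0.
  move: v2G; rewrite v2E mul_mxrow_mxcol.
  (* Column [i] of the product involves block [i] alone, because the input matrix is block
     diagonal. *)
  move=> /(congr1 (mulmx^~ (delta_mx i (0 : 'I_1)))).
  rewrite mul0mx mulmx_suml (bigD1 i) //= big1 => [|j ji].
    by rewrite -!mulmxA mul_delta_mx [delta_mx 0 0]mx11_scalar mxE /= mulmx1 addr0.
  by rewrite -!mulmxA mul_delta_mx_0 ?mulmx0.
by rewrite v2E -[RHS]mxrow0; apply/eq_mxrow => i; apply: hF (qF i) (qg i).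
Qed.

(** Here [q k] and [e k] stand for the derivatives of order [k] of the model state and of its input
    at one instant, so the argument is purely algebraic. Each order of differentiation is traded for
    a factor [F]; the input shows up only at the power [b], which is reached just once, in the term
    of order [b.+1], and with [e 0]. Cayley-Hamilton cancels the rest. *)
Lemma internal_model_readout (K : fieldType) b (F : 'M[K]_b.+1) (g : 'cV[K]_b.+1)
    (c : 'rV[K]_b.+1) (q : nat -> 'cV[K]_b.+1) (e : nat -> 'M[K]_1) :
  (forall k, (k <= b)%N -> c *m F ^+ k *m g = (k == b)%:R%:M) ->
  (forall k, q k.+1 = F *m q k + g *m e k) ->
  c *m (\sum_(k < b.+2) (char_poly F)`_k *: q k) = e 0%N.
Proof.
move=> cFg qS.
have step j k : (j <= b)%N ->
    c *m F ^+ j *m q k.+1 = c *m F ^+ j.+1 *m q k + (j == b)%:R *: e k.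
  by move=> jb; rewrite qS mulmxDr !mulmxA cFg // mul_scalar_mx exprSr -mulmxE mulmxA.
have low k j : (j + k <= b)%N -> c *m F ^+ j *m q k = c *m F ^+ (j + k) *m q 0%N.
  elim: k j => [|k IH] j jk; first by rewrite addn0.
  have jb : (j < b)%N by rewrite (leq_trans _ jk) // -addSnnS leq_addr.
  by rewrite step 1?ltnW // ltn_eqF // scale0r addr0 IH addSnnS.
have top k j : (j + k = b)%N ->
    c *m F ^+ j *m q k.+1 = c *m F ^+ b.+1 *m q 0%N + e 0%N.
  elim: k j => [|k IH] j jk.
    by rewrite addn0 in jk; rewrite step jk // eqxx scale1r.
  have jb : (j < b)%N by rewrite -jk -addSnnS leq_addr.
  by rewrite step 1?ltnW // ltn_eqF // scale0r addr0 IH // addSnnS.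
rewrite big_ord_recr /= mulmxDr.
have := congr1 (fun X => c *m X *m q 0%N) (Cayley_Hamilton_sum F).
rewrite mulmx0 mul0mx [\sum_(k < b.+2) _]big_ord_recr /= mulmxDr mulmxDl.
have := monicP (char_poly_monic F); rewrite lead_coefE size_char_poly /= => ->.
rewrite !scale1r.
have := top b 0%N (add0n b); rewrite expr0 mulmx1 => ->.
rewrite addrA => CH; rewrite -[RHS]add0r -CH; congr (_ + _ + _).
rewrite !mulmx_sumr mulmx_suml; apply: eq_bigr => k _.
rewrite -!scalemxAr -scalemxAl; congr (_ *: _).
by have := low k 0%N (ltn_ord k : (k <= b)%N); rewrite expr0 mulmx1 add0n.
Qed.

(** When every eigenvalue has non-negative real part, stabilizability tests all of them and amounts
    to controllability. *)
Lemma stabilizable_hautus (R : realType) n r (A : 'M[R]_n) (B : 'M[R]_(n, r)) :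
  (forall s, root (map_poly (real_complex R) (char_poly A)) s -> 0 <= complex.Re s) ->
  stabilizable A B -> hautus (complex_mx A) (complex_mx B).
Proof.
move=> Aroots sAB l v vA vB; have [//|v0] := eqVneq v 0.
have ev : eigenvalue (complex_mx A) l by apply/eigenvalueP; exists v.
have /eqP/row_free_inj rf : \rank (row_mx (l%:M - complex_mx A) (complex_mx B)) = n.
  by apply: sAB => //; apply: Aroots; rewrite map_char_poly -eigenvalue_root_char.
apply: rf; rewrite mul0mx mul_mx_row vB mulmxBr vA mul_mx_scalar subrr.
exact: row_mx0.
Qed.

Lemma servo_feedback (R : realType) (n r d b : nat)
    (A : 'M[R]_n) (B : 'M[R]_(n, r)) (D : 'M[R]_(d, n))
    (F : 'I_d -> 'M[R]_b) (g : 'I_d -> 'cV[R]_b) :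
  controllable A B -> (d <= r)%N ->
  (forall s : R[i], transmission_zero A B D s ->
     ~~ eigenvalue (complex_mx (model_F F)) s) ->
  (forall i, hautus (complex_mx (F i)) (complex_mx (g i))) ->
  exists (K1 : 'M[R]_(r, n)) (K2 : 'M[R]_(r, \sum_(i < d) b)),
    (block_mx (A + B *m K1) (B *m K2) (model_Gamma g *m D) (model_F F) + 1%:M)
      ^+ (n + \sum_(i < d) b) = 0.
Proof.
move=> cAB dr cZ hF.
have hAB : hautus (complex_mx A) (complex_mx B).
  exact/kalman_hautus/kalman_rank.
pose AA := block_mx A 0 (model_Gamma g *m D) (model_F F).
pose BB := col_mx B (0 : 'M[R]_(\sum_(i < d) b, r)).
have hAABB : hautus (complex_mx AA) (complex_mx BB).
  rewrite /complex_mx map_block_mx map_col_mx !map_mx0 map_mxM map_mxcol map_mxdiag.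
  under eq_mxcol do rewrite map_mxM map_delta_mx.
  apply: hautus_servo => // l ev.
  have : ~ transmission_zero A B D l by move=> /cZ; rewrite /complex_mx map_mxdiag ev.
  (* Since [d <= r], the rank threshold [n + minn r d] is the number of rows, so the absence of a
     zero means full row rank. *)
  rewrite /transmission_zero (minn_idPr dr) => /negP; rewrite -leqNgt => rk.
  by rewrite /row_free eqn_leq rank_leq_row.
have : kalman_full (AA + 1%:M) BB.
  apply: (@kalman_full_map _ _ (real_complex R)).
  rewrite map_mxD map_mx1; apply/hautus_kalman/hautus_shift/hAABB.
case/kalman_deadbeat => L HL.
exists (lsubmx L), (rsubmx L); rewrite -[RHS]HL.
congr (_ ^+ _); rewrite addrAC; congr (_ + _).
by rewrite -[L in RHS]hsubmxK mul_col_row add_block_mx !mul0mx !addr0 add0r.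
Qed.

(** * Relaxation of linear differential equations *)

Lemma is_derive_mxP (R : realFieldType) m n (f : R -> 'M[R]_(m, n)) t
    (df : 'M[R]_(m, n)) :
  is_derive t (1 : R) f df <->
  forall i j, is_derive t (1 : R) (fun s => f s i j) (df i j).
Proof.
split=> [[fd fE] i j|H].
  have fdij := (derivable_mxP f t 1).1 fd.
  by split; [exact: fdij | rewrite -fE derive_mx // mxE].
have fd : derivable f t 1 by apply/derivable_mxP => i j; case: (H i j).
split=> //; rewrite derive_mx //; apply/matrixP => i j.
by rewrite mxE; case: (H i j).
Qed.

Lemma is_derive_mulmx (R : realFieldType) m n p (A : 'M[R]_(m, n))
    (f : R -> 'M[R]_(n, p)) t (df : 'M[R]_(n, p)) :
  is_derive t (1 : R) f df -> is_derive t (1 : R) (fun s => A *m f s) (A *m df).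
Proof.
move=> /is_derive_mxP H; apply/is_derive_mxP => i j.
rewrite mxE (_ : (fun s => _) = \sum_(k < n) (A i k *: (fun s => f s k j))); last first.
  by apply/funext => s; rewrite mxE fct_sumE.
by apply: is_derive_sum => k; apply: is_deriveZ.
Qed.

Lemma is_derive_col_mx (R : realFieldType) m n p (f : R -> 'M[R]_(m, p))
    (g : R -> 'M[R]_(n, p)) t df dg :
  is_derive t (1 : R) f df -> is_derive t (1 : R) g dg ->
  is_derive t (1 : R) (fun s => col_mx (f s) (g s)) (col_mx df dg).
Proof.
move=> /is_derive_mxP Hf /is_derive_mxP Hg; apply/is_derive_mxP => i j.
rewrite mxE (_ : (fun s => _) =
    (fun s => match fintype.split i with inl k => f s k j | inr k => g s k j end)).
  by case: (fintype.split i).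
by apply/funext => s; rewrite mxE.
Qed.

Lemma cvg_mxP (R : realFieldType) m n (T : Type) (F : set_system T) {FF : Filter F}
    (f : T -> 'M[R]_(m, n)) (a : 'M[R]_(m, n)) :
  f @ F --> a <-> forall i j, f x i j @[x --> F] --> a i j.
Proof.
split=> [fa i j|H].
  exact: (@cvg_comp _ _ _ f (fun M : 'M[R]_(m, n) => M i j) _ _ _ fa
    (@coord_continuous _ _ _ i j a)).
apply/cvgrPdist_le => /= e e0; near=> x.
rewrite [leLHS]/Num.Def.normr/= mx_normrE (bigmax_le _ (ltW e0))//= => i _.
rewrite !mxE/=; move: i; near: x; apply: filter_forall => /= i.
exact: ((cvgrPdist_le _ _).1 (H i.1 i.2)).
Unshelve. all: by end_near. Qed.

Lemma cvg_mulmx0 (R : realFieldType) m n p (T : Type) (F : set_system T)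
    {FF : Filter F} (A : 'M[R]_(m, n)) (f : T -> 'M[R]_(n, p)) :
  f @ F --> (0 : 'M[R]_(n, p)) -> A *m f x @[x --> F] --> (0 : 'M[R]_(m, p)).
Proof.
move=> /cvg_mxP H; apply/cvg_mxP => i j.
rewrite (_ : (fun x => _) = (fun x => \sum_(k < n) A i k * f x k j)); last first.
  by apply/funext => x; rewrite mxE.
rewrite mxE [X in _ --> X](_ : _ = \sum_(k < n) A i k * 0); last first.
  by rewrite big1 // => k _; rewrite mulr0.
apply: cvg_big => [|k _]; first exact: add_continuous.
apply: cvgM; first exact: cvg_cst.
by have := H k j; rewrite mxE.
Qed.

(** Integrating factor: [expR t * (f t - e / 2)] has derivative [expR t * (g t - e / 2)], which is
    nonpositive once [g] is below [e / 2]. Hence [f] exceeds [e / 2] by at most a multiple of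
    [expR (- t)]. *)
Lemma relaxation_upper (R : realType) (f g : R -> R) :
  (forall t : R, 0 < t -> is_derive t (1 : R) f (g t - f t)) ->
  g t @[t --> +oo] --> (0 : R) ->
  forall e, 0 < e -> \forall t \near +oo, f t <= e.
Proof.
move=> fd g0 e e0; have e20 : 0 < e / 2 by rewrite divr_gt0.
have [T [Treal gT]] : \forall t \near +oo, g t <= e / 2.
  have /cvgrPdist_le /(_ _ e20) := g0; apply: filterS => t.
  by rewrite sub0r normrN; apply: le_trans; exact: ler_norm.
(* The starting time must lie strictly beyond [T] and strictly beyond 0, where the equation begins
   to hold. *)
pose a := Num.max T 0 + 1.
have a0 : 0 < a by rewrite ltr_pwDr // le_max lexx orbT.
have aT x : a <= x -> T < x.
  by apply: lt_le_trans; rewrite ltr_pwDr // le_max lexx.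
pose h : R -> R := expR * (f - cst (e / 2)).
have hd t : a <= t -> is_derive t (1 : R) h (expR t * (g t - e / 2)).
  move=> at_; have ft := fd t (lt_le_trans a0 at_).
  apply: is_derive_eq.
  rewrite subr0 /GRing.scale /= mulrC -mulrDl mulrC; congr (_ * _).
  by rewrite addrA subrK.
have hdec t : a <= t -> h t <= h a.
  move=> at_; apply: (@ler0_derive1_nincry _ h a) => //.
  - by move=> x; rewrite in_itv /= andbT => /ltW /hd [].
  - move=> x; rewrite in_itv /= andbT => /ltW ax.
    rewrite derive1E (@derive_val _ _ _ _ _ _ _ (hd x ax)).
    by rewrite pmulr_rle0 ?expR_gt0 // subr_le0 gT // aT.
  - apply: derivable_within_continuous => x.
    by rewrite in_itv /= andbT => /hd [].
have lim0 : h a * expR (- t) @[t --> +oo] --> (0 : R).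
  rewrite -[X in _ --> X](mulr0 (h a)).
  by apply: cvgM; [exact: cvg_cst | exact: cvgr_expR].
have /cvgrPdist_le /(_ _ e20) hT := lim0.
near=> t.
have at_ : a <= t by near: t; apply: nbhs_pinfty_ge; rewrite num_real.
have hE : f t = h t * expR (- t) + e / 2.
  have -> : h t = expR t * (f t - e / 2) by [].
  by rewrite mulrAC -expRD subrr expR0 mul1r subrK.
have hat : h a * expR (- t) <= e / 2.
  by apply: le_trans (ler_norm _) _; rewrite -normrN -sub0r; near: t.
rewrite hE [leRHS](splitr e) lerD2r (le_trans _ hat) //.
by rewrite ler_wpM2r ?expR_ge0 ?hdec.
Unshelve. all: by end_near. Qed.

(** The equation is linear, so the lower bound is the upper bound for [- f] and [- g]. *)
Lemma relaxation_cvg0 (R : realType) (f g : R -> R) :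
  (forall t : R, 0 < t -> is_derive t (1 : R) f (g t - f t)) ->
  g t @[t --> +oo] --> (0 : R) -> f t @[t --> +oo] --> (0 : R).
Proof.
move=> fd g0; apply/cvgrPdist_le => /= e e0; near=> t.
rewrite sub0r normrN ler_norml lerNl; apply/andP; split; last first.
  by near: t; apply: relaxation_upper g0 _ e0.
near: t; apply: (@relaxation_upper _ (fun t => - f t) (fun t => - g t)) => //.
  by move=> t /fd ft; rewrite -opprD; apply: is_deriveN.
by rewrite -[X in _ --> X]oppr0; apply: cvgN.
Unshelve. all: by end_near. Qed.

(** Each [(M + 1%:M) ^+ j *m f] relaxes with rate 1 towards the one with exponent [j.+1], and the
    one with exponent [N] vanishes. *)
Lemma nilpotent_shift_cvg0 (R : realType) m N (M : 'M[R]_m) (f : R -> 'cV[R]_m) :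
  (M + 1%:M) ^+ N = 0 ->
  (forall t : R, 0 < t -> is_derive t (1 : R) f (M *m f t)) ->
  f t @[t --> +oo] --> (0 : 'cV[R]_m).
Proof.
move=> MN fd.
suff H k : (k <= N)%N ->
    (M + 1%:M) ^+ (N - k) *m f t @[t --> +oo] --> (0 : 'cV[R]_m).
  have := H N (leqnn N); rewrite subnn expr0.
  by under eq_fun do rewrite mul1mx.
elim: k => [|k IH] kN.
  rewrite subn0 MN; under eq_fun do rewrite mul0mx.
  exact: cvg_cst.
apply/cvg_mxP => i j; rewrite mxE.
apply: (@relaxation_cvg0 _ _ (fun t => ((M + 1%:M) ^+ (N - k) *m f t) i j)).
  move=> t /fd /(is_derive_mulmx ((M + 1%:M) ^+ (N - k.+1))) /is_derive_mxP /(_ i j).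
  suff -> : (M + 1%:M) ^+ (N - k.+1) *m (M *m f t) =
      (M + 1%:M) ^+ (N - k) *m f t - (M + 1%:M) ^+ (N - k.+1) *m f t.
    by rewrite !mxE.
  rewrite -[(N - k)%N]prednK ?subn_gt0 // -subnS exprSr -mulmxE.
  by rewrite -mulmxA mulmxDl mul1mx mulmxDr addrK.
by have /cvg_mxP/(_ i j) := IH (ltnW kN); rewrite mxE.
Qed.

(** * Tracking *)

(* The k-th derivative of a solution of [x' = M x + h 0], where [h k] stands
   for the k-th derivative of [h 0]; no smoothness of [x] is presupposed. *)
Fixpoint jet (R : realType) m (M : 'M[R]_m) (h : nat -> R -> 'cV[R]_m)
    (x : R -> 'cV[R]_m) k : R -> 'cV[R]_m :=
  if k is k'.+1 then fun t => M *m jet M h x k' t + h k' t else x.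

Section Jet.
Variables (R : realType) (m b : nat) (M : 'M[R]_m).
Variables (h : nat -> R -> 'cV[R]_m) (x : R -> 'cV[R]_m).
Hypothesis h_derive : forall k, (k < b)%N ->
  forall t : R, 0 < t -> is_derive t (1 : R) (h k) (h k.+1 t).
Hypothesis x_derive :
  forall t : R, 0 < t -> is_derive t (1 : R) x (M *m x t + h 0%N t).

(** Order [k] of the jet contains the forcing only up to [h k.-1], so order [b] is still
    differentiable although [h b] need not be. *)
Lemma jet_derive k : (k <= b)%N ->
  forall t : R, 0 < t -> is_derive t (1 : R) (jet M h x k) (jet M h x k.+1 t).
Proof.
elim: k => [|k IH] kb t t0; first exact: x_derive.
apply: is_deriveD; last exact: h_derive.
by apply: is_derive_mulmx; apply: IH => //; exact: ltnW.
Qed.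

Lemma jet_annihilated (phi : {poly R}) :
  (forall t : R, 0 < t -> \sum_(k < b.+1) phi`_k *: h k t = 0) ->
  forall t : R, 0 < t ->
    is_derive t (1 : R) (fun s => \sum_(k < b.+1) phi`_k *: jet M h x k s)
      (M *m \sum_(k < b.+1) phi`_k *: jet M h x k t).
Proof.
move=> h0 t t0.
have -> : M *m (\sum_(k < b.+1) phi`_k *: jet M h x k t) =
    \sum_(k < b.+1) phi`_k *: jet M h x k.+1 t.
  under [RHS]eq_bigr do rewrite /= scalerDr scalemxAr.
  by rewrite big_split /= h0 // addr0 mulmx_sumr.
rewrite (_ : (fun s => _) = \sum_(k < b.+1) (phi`_k *: jet M h x k)); last first.
  by apply/funext => s; rewrite fct_sumE.
by apply: is_derive_sum => k; apply: is_deriveZ; apply: jet_derive (ltn_ord k) _ t0.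
Qed.

End Jet.

(** Entrywise, to match the componentwise hypotheses on the signals. *)
Definition mx_derive1n (R : realType) m n k (f : R -> 'M[R]_(m, n)) (t : R) :
    'M[R]_(m, n) :=
  \matrix_(i, j) derive1n k (fun s => f s i j) t.

Lemma ode_mx_derive (R : realType) m (phi : {poly R}) b (f : R -> 'cV[R]_m) :
  size phi = b.+1 -> all_components_ode phi f -> forall k, (k < b)%N ->
  forall t : R, 0 < t -> is_derive t (1 : R) (mx_derive1n k f) (mx_derive1n k.+1 f t).
Proof.
move=> sphi hf k kb t t0; apply/is_derive_mxP => i j.
rewrite mxE derive1nS derive1E ord1.
rewrite (_ : (fun s => mx_derive1n k f s i 0) =
    derive1n k (fun s => f s i 0)); last first.
  by apply/funext => s; rewrite mxE.
by apply: derivableP; have [] := hf i t t0; rewrite sphi => /(_ k kb).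
Qed.

Lemma ode_mx_annihilated (R : realType) m (phi : {poly R}) b (f : R -> 'cV[R]_m) :
  size phi = b.+1 -> all_components_ode phi f ->
  forall t : R, 0 < t -> \sum_(k < b.+1) phi`_k *: mx_derive1n k f t = 0.
Proof.
move=> sphi hf t t0; apply/colP => i; rewrite summxE mxE.
have [_] := hf i t t0; rewrite sphi => f0; rewrite -[RHS]f0.
by apply: eq_bigr => k _; rewrite !mxE.
Qed.

(** Block [i] of the model is driven by component [i] of the error alone. The row [c] is fixed
    before [q] and [e], so that one [c] serves all times in the limit argument. *)
Lemma internal_model_readout_sum (R : realType) d b (phi : {poly R})
    (F : 'I_d -> 'M[R]_b) (g : 'I_d -> 'cV[R]_b) (i : 'I_d) :
  (0 < b)%N -> char_poly (F i) = phi -> kalman_full (F i) (g i) ->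
  exists c : 'rV[R]_b,
  forall (q : nat -> 'cV[R]_(\sum_(i < d) b)) (e : nat -> 'cV[R]_d),
    (forall k, q k.+1 = model_F F *m q k + model_Gamma g *m e k) ->
    c *m submxcol (\sum_(k < b.+1) phi`_k *: q k) i = row i (e 0%N).
Proof.
case: b F g => // b F g _ <- kFg.
have [c cFg] := kalman_dual_vector kFg.
exists c => q e qS.
rewrite -(internal_model_readout (q := fun k => submxcol (q k) i)
  (e := fun k => row i (e k)) cFg).
  congr (_ *m _); apply/matrixP => k j; rewrite mxE !summxE.
  by apply: eq_bigr => s _; rewrite !mxE.
move=> k; rewrite qS -{1}[q k]submxcolK mul_mxdiag_mxcol mxcol_mul -mxcolD mxcolK.
by rewrite -mulmxA -rowE.
Qed.

Theorem theorem10p2 (R : realType) (n r d p b : nat)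
    (A : 'M[R]_n) (B : 'M[R]_(n, r)) (E : 'M[R]_(n, p)) (D : 'M[R]_(d, n))
    (rankB : \rank B = r) (rankD : \rank D = d)
    (ctrlAB : controllable A B) (obsAD : observable A D)
    (phi : {poly R}) (phi_monic : phi \is monic) (size_phi : size phi = b.+1)
    (phi_zeros : forall s : R[i],
       root (map_poly (real_complex R) phi) s -> 0 <= complex.Re s)
    (F : 'I_d -> 'M[R]_b) (g : 'I_d -> 'cV[R]_b)
    (char_F : forall i : 'I_d, char_poly (F i) = phi)
    (cond_a : stabilizable A B)
    (cond_b : (d <= r)%N)
    (cond_c : forall s : R[i], transmission_zero A B D s ->
       ~~ eigenvalue (complex_mx (model_F F)) s)
    (cond_d : forall i : 'I_d, stabilizable (F i) (g i)) :
  exists (K1 : 'M[R]_(r, n)) (K2 : 'M[R]_(r, \sum_(i < d) b)),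
    assures_tracking A B E D (model_F F) (model_Gamma g) K1 K2 phi.
Proof.
have hF i : hautus (complex_mx (F i)) (complex_mx (g i)).
  by apply: stabilizable_hautus (cond_d i) => s; rewrite char_F; exact: phi_zeros.
have kF i : kalman_full (F i) (g i).
  by apply: (@kalman_full_map _ _ (real_complex R)); exact/hautus_kalman/hF.
have [K1 [K2]] := servo_feedback ctrlAB cond_b cond_c hF.
set M := block_mx _ _ _ _ => MN; exists K1, K2 => w zref hw hz x q cl.
set FF := model_F F in M MN cl; set G := model_Gamma g in M MN cl.
(* The forcing of the combined state is [E *m w] on the plant and [- G *m zref] on the internal
   model; [h k] is its derivative of order [k]. *)
pose h k t := col_mx E 0 *m mx_derive1n k w t - col_mx 0 G *m mx_derive1n k zref t.
have hE k t : h k t = col_mx (E *m mx_derive1n k w t) (- (G *m mx_derive1n k zref t)).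
  by rewrite /h !mul_col_mx !mul0mx opp_col_mx add_col_mx oppr0 addr0 add0r.
pose X t := col_mx (x t) (q t).
have mx0 m (f : R -> 'cV[R]_m) t : mx_derive1n 0 f t = f t.
  by apply/matrixP => i j; rewrite mxE.
have Xd (t : R) : 0 < t -> is_derive t (1 : R) X (M *m X t + h 0%N t).
  move=> /cl [xd qd]; apply: is_derive_eq (is_derive_col_mx xd qd) _.
  rewrite /M /X hE !mx0 mul_block_col add_col_mx; congr col_mx.
    by rewrite mulmxDl mulmxDr !mulmxA addrA.
  by rewrite mulmxBr addrA mulmxA (addrC (FF *m _)).
have hd k : (k < b)%N -> forall t : R, 0 < t -> is_derive t (1 : R) (h k) (h k.+1 t).
  move=> kb t t0; apply: is_deriveB; apply: is_derive_mulmx.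
    exact: ode_mx_derive hw _ kb _ t0.
  exact: ode_mx_derive hz _ kb _ t0.
have h0 (t : R) : 0 < t -> \sum_(k < b.+1) phi`_k *: h k t = 0.
  move=> t0; transitivity (\sum_(k < b.+1)
      (col_mx E 0 *m (phi`_k *: mx_derive1n k w t) -
       col_mx 0 G *m (phi`_k *: mx_derive1n k zref t))).
    by apply: eq_bigr => k _; rewrite scalerBr !scalemxAr.
  by rewrite sumrB -!mulmx_sumr !(ode_mx_annihilated size_phi _ t0) // !mulmx0 subr0.
pose Y t := \sum_(k < b.+1) phi`_k *: jet M h X k t.
have Y0 : Y t @[t --> +oo] --> (0 : 'cV[R]_(n + \sum_(i < d) b)).
  exact: nilpotent_shift_cvg0 MN (jet_annihilated hd Xd h0).
(* For [b = 0] there is no internal model to read the error from. Then [phi = 1] forces [zref] to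
   vanish for positive times, and [Y] is the state itself. *)
have [b0|b_gt0] := posnP b.
  subst b; have phi0 : phi`_0 = 1.
    by have := monicP phi_monic; rewrite lead_coefE size_phi.
  have : D *m usubmx (Y t) @[t --> +oo] --> (0 : 'cV[R]_d).
    apply: cvg_mulmx0; apply/cvg_mxP => i j.
    rewrite mxE; under eq_fun do rewrite mxE.
    by have /cvg_mxP/(_ (lshift _ i) j) := Y0; rewrite mxE.
  apply: cvg_trans; apply: near_eq_cvg; near=> t.
  have t0 : 0 < t by near: t; apply: nbhs_pinfty_gt; rewrite num_real.
  have := ode_mx_annihilated size_phi hz t0; rewrite big_ord1 phi0 scale1r mx0 => ->.
  by rewrite /Y big_ord1 phi0 scale1r /= col_mxKu subr0.
apply/cvg_mxP => i j; rewrite ord1 mxE.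
(* At each fixed [t] the jets obey the recursion of the internal model by construction, and [ej 0]
   is the tracking error. *)
pose qj k t := dsubmx (jet M h X k t).
pose ej k t := D *m usubmx (jet M h X k t) - mx_derive1n k zref t.
have qjS t k : qj k.+1 t = FF *m qj k t + G *m ej k t.
  rewrite /qj /ej /= hE -{1}[jet M h X k t]vsubmxK mul_block_col add_col_mx col_mxKd.
  by rewrite mulmxBr mulmxA addrA (addrC (FF *m _)).
have [c cE] := internal_model_readout_sum b_gt0 (char_F i) (kF i).
(* The error is a fixed linear image of [Y], so it inherits the limit 0. *)
have eY t : row i (D *m x t - zref t) = c *m submxcol (dsubmx (Y t)) i.
  transitivity (row i (ej 0%N t)); first by rewrite /ej mx0 col_mxKu.
  rewrite -(cE (qj^~ t) (ej^~ t)) //; congr (_ *m submxcol _ i).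
  apply/matrixP => k l; rewrite mxE !summxE.
  by apply: eq_bigr => s _; rewrite !mxE.
have : c *m submxcol (dsubmx (Y t)) i @[t --> +oo] --> (0 : 'M[R]_1).
  apply: cvg_mulmx0; apply/cvg_mxP => k l.
  rewrite mxE; under eq_fun do rewrite !mxE.
  set kk := rshift _ _.
  by have /cvg_mxP/(_ kk l) := Y0; rewrite mxE.
move=> /cvg_mxP /(_ 0 0); rewrite mxE.
suff -> : (fun t => (c *m submxcol (dsubmx (Y t)) i) 0 0) =
    (fun t => (D *m x t - zref t) i 0) by [].
by apply/funext => t; rewrite -eY mxE.
Unshelve. all: by end_near. Qed.
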